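(* Let $\mathcal H$ and $\mathcal G$ be real Hilbert spaces, let $z\in\mathcal H$, let $r\in\mathcal G$, let $f\colon\mathcal H\to\,]-\infty,+\infty]$ and $g\colon\mathcal G\to\,]-\infty,+\infty]$ be lower semicontinuous convex functions, and let $L\colon\mathcal H\to\mathcal G$ be a nonzero bounded linear operator such that $r\in\operatorname{sri}\big(L(\operatorname{dom}f)-\operatorname{dom}g\big)$. Let $v$ be a solution to the problem $$\underset{v\in\mathcal G}{\text{minimize}}\;\;\widetilde{f^*}(z-L^*v)+g^*(v)+\langle v\mid r\rangle,$$ and set $x=\operatorname{prox}_f(z-L^*v)$. Then $x$ is the (unique) solution to the problem $$\underset{x\in\mathcal H}{\text{minimize}}\;\; f(x)+g(Lx-r)+\tfrac12\|x-z\|^2.$$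
   Context: For a function $\varphi$ with values in $]-\infty,+\infty]$, $\operatorname{dom}\varphi=\{x : \varphi(x)<+\infty\}$. For a nonempty convex set $C$ in a Hilbert space, $\operatorname{cone}C=\bigcup_{\lambda>0}\{\lambda x: x\in C\}$, and the strong relative interior is $\operatorname{sri}C=\{x\in C:\operatorname{cone}(C-x)=\overline{\operatorname{span}}(C-x)\}$, where $\overline{\operatorname{span}}$ is the closed linear span (and $\operatorname{sri}\varnothing=\varnothing$; thus the hypothesis implies that $f$ and $g$ are proper). For $\varphi$ proper, lower semicontinuous and convex on a real Hilbert space: $\varphi^*(u)=\sup_x\langle x\mid u\rangle-\varphi(x)$ is its conjugate; $\widetilde{\varphi}(x)=\min_y\varphi(y)+\frac12\|x-y\|^2$ is its Moreau envelope (so $\widetilde{f^*}$ is the Moreau envelope of $f^*$); and $\operatorname{prox}_\varphi x$ is the unique minimizer of $y\mapsto\varphi(y)+\frac12\|x-y\|^2$. $L^*$ denotes the adjoint of $L$. *)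

(* Defs.v *)
From HB Require Import structures.
From mathcomp Require Import all_boot all_order all_algebra.
From mathcomp Require Import sesquilinear.
From mathcomp Require Import all_classical all_reals all_analysis.

Set Implicit Arguments.
Unset Strict Implicit.
Unset Printing Implicit Defensive.

Import Order.TTheory GRing.Theory Num.Theory.
Import numFieldNormedType.Exports.

Local Open Scope classical_set_scope.
Local Open Scope ring_scope.

HB.mixin Record NormedModule_isPreHilbert (R : realType) V
    & NormedModule R V := {
  dotp : V -> V -> R ;
  dotp_scalarl : forall y : V, scalar (dotp^~ y) ;
  dotpC : forall x y : V, dotp x y = dotp y x ;
  dotpE : forall x : V, dotp x x = `|x| ^+ 2
}.

#[short(type="hilbertType")]
HB.structure Definition Hilbert (R : realType) :=
  {V of CompleteNormedModule R V & NormedModule_isPreHilbert R V}.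

Section dotp_instance.
Context {R : realType} {H : hilbertType R}.

Let dotp_bilinear :
  bilinear_for *%R (idfun \; *%R) (dotp : H -> H -> R).
Proof.
split=> [y|x] a u v /=; first exact: dotp_scalarl.
by rewrite dotpC dotp_scalarl !(dotpC _ x).
Qed.

HB.instance Definition _ :=
  bilinear_isBilinear.Build R H H R _ _ (dotp : H -> H -> R) dotp_bilinear.

Let dotp_hermitian (x y : H) :
  dotp x y = (-1) ^+ false * idfun (dotp y x) :> R.
Proof. by rewrite mul1r dotpC. Qed.

HB.instance Definition _ := isHermitianSesquilinear.Build R H false idfun
  (dotp : H -> H -> R) dotp_hermitian.

Let dotp_gt0 (x : H) : x != 0 -> 0 < dotp x x :> R.
Proof. by move=> x0; rewrite dotpE exprn_gt0// normr_gt0. Qed.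

HB.instance Definition _ :=
  isDotProduct.Build R H (dotp : H -> H -> R) dotp_gt0.

End dotp_instance.

Section subspaces.
Context {R : realType} {V : normedModType R}.
Implicit Types (A C : set V) (x : V).

Definition linear_span A : set V :=
  smallest [set S : set V | submod_closed [in S]] A.

Definition closed_span A : set V := closure (linear_span A).

Definition cone C : set V :=
  \bigcup_(l in [set l : R | 0 < l]) [set l *: x | x in C].

(* strong relative interior *)
Definition sri C : set V :=
  [set x | C x /\
    cone [set y - x | y in C] = closed_span [set y - x | y in C]].

End subspaces.

Section extended_functions.
Context {R : realType}.
Local Open Scope ereal_scope.

Definition dom {T : Type} (phi : T -> \bar R) : set T :=
  [set x | phi x < +oo].

Definition argmin {T : Type} (phi : T -> \bar R) : set T :=
  [set x | forall y, phi x <= phi y].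

(* The values are meant to be in ]-oo, +oo], so that the sum on the right is
   never of the form +oo + -oo *)
Definition convex_efun {V : lmodType R} (phi : V -> \bar R) : Prop :=
  forall (x y : V) (t : R), (0 < t < 1)%R ->
    phi (t *: x + (1 - t) *: y)%R <= t%:E * phi x + (1 - t)%:E * phi y.

Context {H : hilbertType R}.
Implicit Types phi : H -> \bar R.

Definition conjugate phi (u : H) : \bar R :=
  ereal_sup (range (fun x => (dotp x u)%:E - phi x)).

Definition prox_objective phi (x y : H) : \bar R :=
  phi y + (2^-1 * `|x - y| ^+ 2)%:E.

(* The infimum is attained when phi is proper, lsc and convex *)
Definition moreau_env phi (x : H) : \bar R :=
  ereal_inf (range (prox_objective phi x)).

(* The minimizer exists and is unique when phi is proper, lsc and convex *)
Definition prox phi (x : H) : H := get (argmin (prox_objective phi x)).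

End extended_functions.

(* For a bounded linear operator L, the Riesz representation theorem provides
   a unique such u for each v *)
Definition adjoint {R : realType} {H G : hilbertType R} (L : H -> G) (v : G) : H :=
  get [set u : H | forall x : H, dotp (L x) v = dotp x u].

(* Main.v *)
(* Put u = z - L^*v, x = prox_f u and p = Lx - r. The envelope of f^* has
   gradient x at u, so Fermat's rule for the dual problem at v reads
   g^*(w) >= g^*(v) + <w - v | p> for all w. Taking w = p + v - q with
   q = prox_g (p + v), where g^*(w) = <q | w> - g q, yields |p - q|^2 <= 0: hence
   p = q and v is a subgradient of g at p. Adding this to the fact that u - x is
   a subgradient of f at x, the primal objective h satisfies
   h y >= h x + |y - x|^2 / 2. *)
Require Import Defs.
From HB Require Import structures.
From mathcomp Require Import all_boot all_order all_algebra.
From mathcomp Require Import all_classical all_reals all_analysis.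
From mathcomp Require Import ring lra.

Import Order.TTheory GRing.Theory Num.Theory.
Import numFieldNormedType.Exports.

Local Open Scope classical_set_scope.
Local Open Scope ring_scope.

(** * Inner product identities *)

Section dotp_theory.
Context {R : realType} {H : hilbertType R}.
Implicit Types x y z : H.

Lemma dotpDl x y z : dotp (x + y) z = dotp x z + dotp y z.
Proof. by rewrite -[x]scale1r dotp_scalarl mul1r scale1r. Qed.

Lemma dotp0l z : dotp 0 z = 0.
Proof. by apply: (@addrI _ (dotp 0 z)); rewrite -dotpDl !addr0. Qed.

Lemma dotpZl a x z : dotp (a *: x) z = a * dotp x z.
Proof. by rewrite -[a *: x]addr0 dotp_scalarl dotp0l addr0. Qed.

Lemma dotpNl x z : dotp (- x) z = - dotp x z.
Proof. by rewrite -scaleN1r dotpZl mulN1r. Qed.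

Lemma dotpDr x y z : dotp z (x + y) = dotp z x + dotp z y.
Proof. by rewrite !(dotpC z) dotpDl. Qed.

Lemma dotpZr a x z : dotp z (a *: x) = a * dotp z x.
Proof. by rewrite !(dotpC z) dotpZl. Qed.

Lemma dotpNr x z : dotp z (- x) = - dotp z x.
Proof. by rewrite !(dotpC z) dotpNl. Qed.

Definition dotp_expand := (dotpDl, dotpDr, dotpNl, dotpNr, dotpZl, dotpZr).

Lemma sqr_normD x y : `|x + y| ^+ 2 = `|x| ^+ 2 + 2 * dotp x y + `|y| ^+ 2.
Proof. by rewrite -!dotpE !dotp_expand (dotpC y x); ring. Qed.

Lemma dotp_extl x y : (forall z, dotp x z = dotp y z) -> x = y.
Proof.
move=> xy; apply/eqP; rewrite -subr_eq0 -normr_eq0 -sqrf_eq0 -dotpE.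
by rewrite dotpDl dotpNl xy subrr.
Qed.

End dotp_theory.

(** Let [t] tend to 0; this turns inequalities along segments into first-order conditions. *)
Lemma le0_of_le_small (R : realFieldType) (A B : R) :
  (forall t, 0 < t < 1 -> A <= t * B) -> A <= 0.
Proof.
move=> AB; rewrite leNgt; apply/negP => A0.
(* The witness [t = A / (2 (A + |B|))] lies in ]0, 1[ and makes [t B] at most [A / 2]. *)
have D0 : 0 < 2 * (A + `|B|) by have := normr_ge0 B; lra.
have D1 : A / (2 * (A + `|B|)) < 1.
  by rewrite ltr_pdivrMr// mul1r; have := normr_ge0 B; lra.
have := AB (A / (2 * (A + `|B|))); rewrite D1 divr_gt0// => /(_ isT).
rewrite mulrAC ler_pdivlMr// leNgt => /negP; apply.
by rewrite ltr_pM2l//; have := ler_norm B; lra.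
Qed.

(** Finiteness of [phi x] excludes the constant [+oo], for which every [u] would satisfy the
    inequality. *)
Definition subdifferential {R : realType} {H : hilbertType R} (phi : H -> \bar R)
    (x : H) : set H :=
  [set u | phi x \is a fin_num /\
    forall y, (phi x + (dotp u (y - x))%:E <= phi y)%E].

(** * Existence of proximal points and the subgradients they produce *)

Section convex_lsc.
Context {R : realType} {H : hilbertType R} (phi : H -> \bar R).
Hypotheses (phi_gtNy : forall x, (-oo < phi x)%E)
  (phi_lsc : lower_semicontinuous phi) (phi_convex : convex_efun phi).
Implicit Types x y : H.

Lemma convex_efun_le x y a b t : 0 < t < 1 ->
  (phi x <= a%:E)%E -> (phi y <= b%:E)%E ->
  (phi (t *: x + (1 - t) *: y)%R <= (t * a + (1 - t) * b)%:E)%E.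
Proof.
move=> /[dup] /andP[t0 t1] t01 xa yb; apply: (le_trans (phi_convex x y t t01)).
by rewrite [leRHS]EFinD !EFinM leeD// lee_wpmul2l// lee_fin; lra.
Qed.

(* phi > phi x0 - 1 on a ball around x0; convexity along the segment from x0
   to y propagates this to a bound linear in |y - x0|. *)
Lemma lsc_convex_lower_bound x0 : dom phi x0 ->
  exists c d : R, forall y, ((d - c * `|y - x0|)%:E <= phi y)%E.
Proof.
move=> domx0; have [a phix0] : exists a, phi x0 = a%:E.
  by exists (fine (phi x0)); rewrite fineK// fin_numElt phi_gtNy.
have [V x0V aV] : exists2 V, nbhs x0 V & forall y, V y -> ((a - 1)%:E < phi y)%E.
  by apply: phi_lsc; rewrite phix0 lte_fin; lra.
have [e /= e0 eV] : exists2 e : R, 0 < e & ball x0 e `<=` V by apply/nbhs_ballP.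
exists (2 / e), (a - 1) => y.
have ce : 0 <= 2 / e * `|y - x0| by rewrite mulr_ge0// divr_ge0// ltW.
case: (ltP `|y - x0| e) => [ye|ey].
  have : V y by apply: eV; rewrite -ball_normE /= distrC.
  by move=> /aV /ltW; apply: le_trans; rewrite lee_fin; lra.
rewrite leNgt; apply/negP => /ltW phiy.
have n0 : 0 < `|y - x0| by exact: lt_le_trans ey.
(* The convex combination then lies at distance [e / 2] from [x0], and the slope [2 / e] brings its
   upper bound to [a - t - 1], below the local bound [a - 1]. *)
pose t := e / (2 * `|y - x0|).
have t0 : 0 < t by rewrite divr_gt0// mulr_gt0.
have t1 : t < 1 by rewrite ltr_pdivrMr ?mulr_gt0// mul1r; lra.
have : (phi x0 <= a%:E)%E by rewrite phix0.
move=> /(convex_efun_le _ _ _ _ t _ phiy); rewrite t0 t1 => /(_ isT).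
apply/negP; rewrite -ltNge.
have -> : t * (a - 1 - 2 / e * `|y - x0|) + (1 - t) * a = a - t - 1.
  by rewrite /t; field; rewrite !gt_eqF.
apply: (@lt_trans _ _ (a - 1)%:E); first by rewrite lte_fin; lra.
apply: aV; apply: eV; rewrite -ball_normE /=.
have -> : x0 - (t *: y + (1 - t) *: x0) = - (t *: (y - x0)).
  by rewrite scalerBr scalerBl scale1r addrCA opprD addrA subrr add0r.
rewrite normrN normrZ gtr0_norm// /t invfM !mulrA mulfVK ?gt_eqF//; lra.
Qed.

(** The quadratic term absorbs a minorant that decreases at most linearly. *)
Lemma prox_objective_lower_bound x :
  dom phi !=set0 -> exists m : R, forall y, (m%:E <= prox_objective phi x y)%E.
Proof.
case=> x0 /lsc_convex_lower_bound[c [d cd]].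
(* With [s = |x - y|], the triangle inequality leaves [s^2 / 2 - |c| s], which is at least
   [- c^2 / 2]. *)
exists (d - `|c| * `|x - x0| - 2^-1 * c ^+ 2) => y.
apply: (@le_trans _ _ ((d - c * `|y - x0|)%:E + (2^-1 * `|x - y| ^+ 2)%:E)%E).
  2: by rewrite leeD2r.
rewrite -EFinD lee_fin.
have tri : `|y - x0| <= `|x - y| + `|x - x0|.
  by rewrite (distrC x y) (le_trans _ (ler_normD _ _))// addrA subrK.
have : c * `|y - x0| <= `|c| * (`|x - y| + `|x - x0|).
  by rewrite (le_trans (ler_norm _))// normrM ler_wpM2l// normr_id.
rewrite -(real_normK (num_real c)); have := sqr_ge0 (`|x - y| - `|c|); nra.
Qed.

(** The gain [8^-1] comes from the parallelogram identity; it forces minimizing sequences to be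
    Cauchy. *)
Lemma prox_objective_midpoint x y y' a b :
  (prox_objective phi x y <= a%:E)%E -> (prox_objective phi x y' <= b%:E)%E ->
  (prox_objective phi x (2^-1 *: y + (1 - 2^-1) *: y')%R <=
    (2^-1 * (a + b) - 8^-1 * `|y - y'| ^+ 2)%:E)%E.
Proof.
rewrite /prox_objective -!leeBrDr// -!EFinB => ya yb.
have h : 0 < (2^-1 : R) < 1 by lra.
apply: (le_trans (convex_efun_le _ _ _ _ _ h ya yb)); rewrite lee_fin.
have -> : x - (2^-1 *: y + (1 - 2^-1) *: y') = 2^-1 *: ((x - y) + (x - y')).
  have -> : 1 - 2^-1 = 2^-1 :> R by lra.
  rewrite -scalerDr addrACA -opprD scalerBr -mulr2n -(scaler_nat _ x).
  by rewrite scalerA mulVf// scale1r.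
have -> : y - y' = (x - y') - (x - y) by rewrite opprB [RHS]addrC subrKA.
by rewrite -!dotpE; move: (x - y) (x - y') => u w; rewrite !dotp_expand (dotpC w u); lra.
Qed.

(** A minimizing sequence is Cauchy, and lower semicontinuity makes its limit a minimizer. *)
Lemma argmin_prox_objective x :
  dom phi !=set0 -> argmin (prox_objective phi x) !=set0.
Proof.
move=> domphi; have [m0 m0P] := prox_objective_lower_bound x domphi.
set F := prox_objective phi x.
have finF : ereal_inf (range F) \is a fin_num.
  rewrite fin_numElt; apply/andP; split.
    rewrite (@lt_le_trans _ _ m0%:E) ?ltNyr//.
    by apply: le_ereal_inf_tmp => _ [y _ <-]; exact: m0P.
  case: domphi => y domy; apply: le_lt_trans (_ : F y < +oo)%E.
    by apply: ereal_inf_lbound; exists y.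
  by rewrite lte_add_pinfty// ltry.
set m := fine (ereal_inf (range F)).
have mE : ereal_inf (range F) = m%:E by rewrite fineK.
have mP y : (m%:E <= F y)%E by rewrite -mE; apply: ereal_inf_lbound; exists y.
have /choice[u uP] : forall n : nat, exists y, (F y <= (m + n.+1%:R^-1)%:E)%E.
  move=> n; have [|_ [y _ <-] ym] := @lb_ereal_inf_adherent _ (range F) n.+1%:R^-1 _ finF.
    by rewrite invr_gt0.
  by exists y; rewrite EFinD -mE ltW.
(* The midpoint value is at least [m], so near-minimizers are close to each other. *)
have closeF y y' e : (F y <= (m + e)%:E)%E -> (F y' <= (m + e)%:E)%E ->
    `|y - y'| ^+ 2 <= 8 * e.
  move=> ye y'e; have := prox_objective_midpoint _ _ _ _ _ ye y'e.
  by move=> /(le_trans (mP _)); rewrite lee_fin; lra.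
have small (e : R) : 0 < e -> \forall n \near \oo, n.+1%:R^-1 < e.
  by move=> e0; exact: (near_infty_natSinv_lt (PosNum e0)).
have : cvg (u @ \oo).
  apply/cauchy_cvgP; apply: cauchy_exP => e e0 /=.
  have [|N _ NP] := small (8^-1 * e ^+ 2); first by rewrite mulr_gt0// exprn_gt0.
  exists (u N); exists N => // n /= Nn; rewrite -ball_normE /=.
  have := NP N (leqnn N) => /= N8.
  have uNn : `|u N - u n| ^+ 2 <= 8 * N.+1%:R^-1.
    apply: closeF => //; apply: (le_trans (uP n)).
    by rewrite lee_fin lerD2l lef_pV2 ?posrE// ler_nat.
  rewrite -(@ltr_pXn2r _ 2) ?nnegrE ?(ltW e0)//.
  apply: le_lt_trans uNn _. by rewrite -ltr_pdivlMl.
move=> /cvg_ex[q uq]; exists q.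
suff Fq : (F q <= m%:E)%E by move=> y; exact: le_trans (mP y).
apply/lee_addgt0Pr => e e0; rewrite -EFinD /F /prox_objective -leeBrDr// -EFinB.
(* Otherwise [phi] exceeds [m + e] minus the quadratic term at [q] on a neighborhood of [q]. For
   large [n], the excess of [F (u n)] over [m] and the variation of the quadratic term are each
   below [e / 2], a contradiction. *)
rewrite leNgt; apply/negP => /phi_lsc[V qV Vphi].
pose c y := 2^-1 * `|x - y| ^+ 2.
have cq : c (u n) @[n --> \oo] --> c q.
  apply: cvgM; first exact: cvg_cst.
  by rewrite expr2; apply: cvgM; apply: cvg_norm; apply: cvgB => //; exact: cvg_cst.
have : \forall n \near \oo, False.
  near=> n.
  have Vn : V (u n) by near: n; exact: uq.
  have n2 : n.+1%:R^-1 < 2^-1 * e by near: n; apply: small; lra.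
  have cn : `|c q - c (u n)| < 2^-1 * e.
    near: n; move: cq => /cvgrPdist_lt; apply; lra.
  have := uP n; rewrite /F /prox_objective -leeBrDr// -EFinB leNgt => /negP; apply.
  apply: le_lt_trans (Vphi _ Vn); rewrite lee_fin.
  move: n2 cn; rewrite -/(c q) -/(c (u n)) ltr_norml; move: (n.+1%:R^-1) => k ? /andP[]; lra.
by case/filter_ex.
Unshelve. all: by end_near. Qed.

(** Compare [q] with [t y + (1 - t) q], use convexity, divide by [t] and let [t] tend to 0. *)
Lemma argmin_prox_objective_subgradient x q : dom phi !=set0 ->
  argmin (prox_objective phi x) q -> subdifferential phi q (x - q).
Proof.
move=> [x0 domx0] qmin.
have finq : phi q \is a fin_num.
  rewrite fin_numElt phi_gtNy /= ltey; apply/negP => /eqP qy.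
  have := qmin x0; rewrite /prox_objective qy addye// leNgt => /negP; apply.
  by rewrite lte_add_pinfty// ltry.
split=> // y; case phiy : (phi y) => [b| |]; last 2 first.
- by rewrite leey.
- by have := phi_gtNy y; rewrite phiy.
case phiq : (phi q) finq => [a| |]// _; rewrite -EFinD lee_fin -subr_le0.
apply: (@le0_of_le_small _ _ (2^-1 * `|y - q| ^+ 2)) => t /[dup] t01 /andP[t0 t1].
have := qmin (t *: y + (1 - t) *: q).
rewrite /prox_objective phiq -EFinD -leeBlDr// -EFinB => qt.
have [yb qa] : (phi y <= b%:E)%E /\ (phi q <= a%:E)%E by rewrite phiy phiq.
have := le_trans qt (convex_efun_le _ _ _ _ _ t01 yb qa); rewrite lee_fin.
have -> : x - (t *: y + (1 - t) *: q) = (x - q) - t *: (y - q).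
  rewrite scalerBr scalerBl scale1r !opprD !opprK !addrA.
  by rewrite (addrAC x).
rewrite -!dotpE; move: (x - q) (y - q) => u w.
rewrite !dotp_expand (dotpC w u) => h; rewrite -(ler_pM2l t0); lra.
Qed.

Lemma prox_subgradient x : dom phi !=set0 ->
  subdifferential phi (prox phi x) (x - prox phi x).
Proof.
move=> domphi; apply: argmin_prox_objective_subgradient => //.
exact: (getPex (argmin_prox_objective x domphi)).
Qed.

End convex_lsc.

(** * Riesz representation and linearity of the adjoint *)

Section adjoint_theory.
Context {R : realType} {H G : hilbertType R} (L : {linear H -> G}).
Hypothesis L_bounded : bounded_fun_norm L.

Lemma bounded_fun_norm_continuous : continuous L.
Proof.
apply: bounded_linear_continuous; have [M MP] := L_bounded 1.
apply/ex_bound; exists M.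
have := @nbhsx_ballx _ H 0 1 ltr01; apply: filterS => x.
by rewrite -ball_normE /= sub0r normrN => /ltW /MP.
Qed.

(* Riesz representation: the vector representing <L . | w> is
   prox_phi 0 for phi = - <L . | w>, whose only subgradient is -L^*w. *)
Lemma dotp_adjoint x w : dotp (L x) w = dotp x (adjoint L w).
Proof.
suff [u uP] : [set u : H | forall x, dotp (L x) w = dotp x u] !=set0.
  exact: (getPex (ex_intro _ u uP)).
pose phi (y : H) : \bar R := (- dotp (L y) w)%:E.
have phi_gtNy y : (-oo < phi y)%E by rewrite ltNyr.
have phi_convex : convex_efun phi.
  move=> a b t _; rewrite /phi linearD !linearZ /= -!EFinM -EFinD lee_fin.
  by rewrite !dotp_expand; lra.
have phi_lsc : lower_semicontinuous phi.
  move=> a c; rewrite lte_fin => ca.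
  (* Polarization reduces the continuity of [phi] to that of the norm. *)
  have polar y : - dotp (L y) w = 2^-1 * (`|L y| ^+ 2 + `|w| ^+ 2 - `|L y + w| ^+ 2).
    by rewrite sqr_normD; lra.
  have : - dotp (L y) w @[y --> a] --> - dotp (L a) w.
    rewrite polar; under eq_cvg do rewrite polar.
    have La := @bounded_fun_norm_continuous a.
    apply: cvgM; first exact: cvg_cst.
    apply: cvgB; first apply: cvgD; [|exact: cvg_cst|].
      by rewrite expr2; apply: cvgM; apply: cvg_norm.
    by rewrite expr2; apply: cvgM; apply: cvg_norm; apply: cvgD => //; exact: cvg_cst.
  move=> /(_ [set s | c < s]) ac.
  exists [set y | c < - dotp (L y) w]; last by move=> y /=; rewrite lte_fin.
  by apply: ac; exact: lt_nbhsr.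
have /(prox_subgradient phi phi_gtNy phi_lsc phi_convex 0)[_] : dom phi !=set0.
  by exists 0; rewrite /dom/= ltry.
set q := prox phi 0 => qP; exists q => y.
(* The subgradient inequality at [q + y'] gives one direction; changing the sign of [y'] gives the
   other. *)
have le y' : dotp (L y') w <= dotp y' q.
  have := qP (q + y'); rewrite /phi -EFinD lee_fin sub0r linearD (addrC q) addrK.
  by rewrite !dotp_expand (dotpC q); lra.
by apply/le_anti; rewrite le /= -lerN2 -!dotpNl -raddfN le.
Qed.

Lemma adjointD w w' : adjoint L (w + w') = adjoint L w + adjoint L w'.
Proof.
by apply: dotp_extl => y; rewrite dotpDl !(dotpC _ y) -!dotp_adjoint dotpDr.
Qed.

Lemma adjointZ a w : adjoint L (a *: w) = a *: adjoint L w.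
Proof.
by apply: dotp_extl => y; rewrite dotpZl !(dotpC _ y) -!dotp_adjoint dotpZr.
Qed.

End adjoint_theory.

(** * Conjugates and the Moreau envelope of a conjugate *)

Section conjugate_theory.
Context {R : realType} {H : hilbertType R} (phi : H -> \bar R).
Implicit Types x u w : H.

Lemma fenchel_young x a w : phi x = a%:E -> ((dotp x w - a)%:E <= conjugate phi w)%E.
Proof. by move=> phix; apply: ereal_sup_ubound; exists x; rewrite // phix EFinB. Qed.

(** Points where [phi] is [+oo] contribute [-oo] to the supremum. *)
Lemma conjugate_le w c : (forall x, (-oo < phi x)%E) ->
  (forall x a, phi x = a%:E -> dotp x w - a <= c) -> (conjugate phi w <= c%:E)%E.
Proof.
move=> phi_gtNy xc; apply: ge_ereal_sup => _ [x _ <-].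
case phix : (phi x) => [a| |]; first by rewrite -EFinB lee_fin (xc x).
  by rewrite leNye.
by have := phi_gtNy x; rewrite phix.
Qed.

(** Equality case of Fenchel-Young: the subgradient inequality says that [x] attains the
    supremum. *)
Lemma conjugate_subgradient x a u : (forall x, (-oo < phi x)%E) -> phi x = a%:E ->
  subdifferential phi x u -> conjugate phi u = (dotp x u - a)%:E.
Proof.
move=> phi_gtNy phix [_ xu]; apply/le_anti/andP; split; last exact: fenchel_young.
apply: conjugate_le => // y b phiy.
by have := xu y; rewrite phix phiy lee_fin !dotp_expand !(dotpC u); lra.
Qed.

Lemma conjugate_convex_le w w' b b' t : (forall x, (-oo < phi x)%E) -> 0 < t < 1 ->
  (conjugate phi w <= b%:E)%E -> (conjugate phi w' <= b'%:E)%E ->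
  (conjugate phi (t *: w + (1 - t) *: w')%R <= (t * b + (1 - t) * b')%:E)%E.
Proof.
move=> phi_gtNy /andP[t0 t1] wb wb'; apply: conjugate_le => // x a phix.
have := le_trans (fenchel_young _ _ w phix) wb.
have := le_trans (fenchel_young _ _ w' phix) wb'.
rewrite !lee_fin !dotp_expand; nra.
Qed.

(** Bound the conjugate by Fenchel-Young at [x]; the resulting quadratic in [w] is smallest at
    [w = u - x]. *)
Lemma moreau_env_conjugate_ge x a u : phi x = a%:E ->
  ((dotp x u - a - 2^-1 * `|x| ^+ 2)%:E <= moreau_env (conjugate phi) u)%E.
Proof.
move=> phix; apply: le_ereal_inf_tmp => _ [w _ <-]; rewrite /prox_objective.
apply: le_trans (leeD2r _ (fenchel_young _ _ w phix)); rewrite lee_fin.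
have := sqr_ge0 (`|u - w - x|).
by rewrite -!dotpE !dotp_expand (dotpC w u) (dotpC x u) (dotpC x w); lra.
Qed.

(* The gradient of the Moreau envelope of phi^* at u is x = prox_phi u and is
   1-Lipschitz: this is the corresponding descent lemma. *)
Lemma moreau_env_conjugate_le x a u u' : (forall x, (-oo < phi x)%E) ->
  phi x = a%:E -> subdifferential phi x (u - x) ->
  (moreau_env (conjugate phi) u' <=
    (dotp x u' - a - 2^-1 * `|x| ^+ 2 + 2^-1 * `|u' - u| ^+ 2)%:E)%E.
Proof.
move=> phi_gtNy phix xu.
(* The test point [u - x] is a subgradient at [x], so the conjugate is explicit there. *)
apply: (@le_trans _ _ (prox_objective (conjugate phi) u' (u - x))).
  by apply: ereal_inf_lbound; exists (u - x).
rewrite /prox_objective (conjugate_subgradient x a)// -EFinD lee_fin.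
rewrite -!dotpE !dotp_expand (dotpC u u') (dotpC u' x) (dotpC u x); lra.
Qed.

End conjugate_theory.

(** * Recovery of the primal solution from a dual one *)

Theorem proposition3p4 (R : realType) (H G : hilbertType R) (z : H) (r : G)
    (f : H -> \bar R) (g : G -> \bar R) (L : {linear H -> G}) (v : G)
    (f_gtNy : forall x, (-oo < f x)%E)
    (f_lsc : lower_semicontinuous f) (f_convex : convex_efun f)
    (g_gtNy : forall y, (-oo < g y)%E)
    (g_lsc : lower_semicontinuous g) (g_convex : convex_efun g)
    (L_bounded : bounded_fun_norm L) (L_neq0 : exists x, L x != 0)
    (r_sri : sri [set L x - y | x in dom f & y in dom g] r)
    (v_sol : argmin (fun w : G =>
      moreau_env (conjugate f) (z - adjoint L w)%R
        + conjugate g w + (dotp w r)%:E)%E v) :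
  let x := prox f (z - adjoint L v) in
  argmin (fun y : H =>
    f y + g (L y - r)%R + (2^-1 * `|y - z| ^+ 2)%:E)%E = [set x].
Proof.
move: r_sri => [[xf domf [yg domg _]] _] x.
set u := z - adjoint L v in x *.
have fx : subdifferential f x (u - x).
  by apply: prox_subgradient => //; exists xf.
have [a fxa] : exists a, f x = a%:E by exists (fine (f x)); rewrite fineK//; case: fx.
have [p pE] : exists p, p = L x - r by exists (L x - r).
(* The goal [p = q] expresses that [v] is a subgradient of [g] at [p]. *)
have [q gq] : exists q, subdifferential g q (p + v - q).
  by exists (prox g (p + v)); apply: prox_subgradient => //; exists yg.
have [b gqb] : exists b, g q = b%:E by exists (fine (g q)); rewrite fineK//; case: gq.
have conjE := conjugate_subgradient g q b _ g_gtNy gqb gq.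
set w := p + v - q in gq conjE.
have env_ge := moreau_env_conjugate_ge f x a u fxa.
have env_le u' := moreau_env_conjugate_le f x a u u' f_gtNy fxa fx.
(* Fenchel-Young at [q] bounds the value below; it is not [+oo] because the dual objective is finite
   at [w] and minimal at [v]. *)
have [c conjv] : exists c, conjugate g v = c%:E.
  exists (fine (conjugate g v)); rewrite fineK// fin_numElt; apply/andP; split.
    exact: lt_le_trans (ltNyr _) (fenchel_young g q b v gqb).
  rewrite ltNge leye_eq; apply/negP => /eqP conjv.
  have := v_sol w; rewrite conjv conjE addey; last first.
    by rewrite -ltNye; exact: lt_le_trans (ltNyr _) env_ge.
  rewrite addye// leNgt => /negP; apply.
  by rewrite !lte_add_pinfty ?ltry// (le_lt_trans (env_le _))// ltry.
(* Move from [v] towards [w], in the direction [w - v = p - q]. The descent lemma leaves an error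
   quadratic in [t], which vanishes after division by [t] as [t] tends to 0. *)
have fermat : c - (dotp q w - b) + dotp p (p - q) <= 0.
  apply: (@le0_of_le_small _ _ (2^-1 * `|adjoint L (p - q)| ^+ 2)).
  move=> t /[dup] t01 /andP[t0 t1].
  have conj_le : (conjugate g (t *: w + (1 - t) *: v)%R <=
      (t * (dotp q w - b) + (1 - t) * c)%:E)%E.
    by apply: conjugate_convex_le => //; [rewrite conjE|rewrite conjv].
  have wE : t *: w + (1 - t) *: v = v + t *: (p - q).
    rewrite /w (addrAC p v) (scalerDr t (p - q)) scalerBl scale1r.
    by rewrite addrC (addrC (t *: (p - q))) subrKA.
  have := v_sol (t *: w + (1 - t) *: v).
  move=> /le_trans /(_ (leeD2r _ (leeD (env_le _) conj_le))).
  rewrite conjv => /(le_trans (leeD2r _ (leeD2r _ env_ge))).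
  rewrite -!EFinD lee_fin wE (adjointD L L_bounded) (adjointZ L L_bounded).
  have -> : z - (adjoint L v + t *: adjoint L (p - q)) =
      u - t *: adjoint L (p - q) by rewrite opprD addrA.
  rewrite (addrAC u _ (- u)) subrr add0r normrN normrZ exprMn (gtr0_norm t0) => ineq.
  rewrite -(ler_pM2l t0); move: ineq.
  rewrite (dotpDr _ (- _)) dotpNr dotpZr -dotp_adjoint// (dotpDl v) (dotpZl t).
  have -> : dotp p (p - q) = dotp (L x) (p - q) - dotp (p - q) r.
    by rewrite {1}pE dotpDl dotpNl (dotpC r).
  lra.
(* Adding Fenchel-Young for [q] and [v] to [fermat] leaves [|p - q|^2 <= 0]. *)
have pq : p = q.
  apply/eqP; rewrite -subr_eq0 -normr_eq0 -sqrf_eq0 -dotpE -(rwP eqP).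
  apply/le_anti; rewrite {2}dotpE sqr_ge0 andbT.
  have := fenchel_young g q b v gqb; rewrite conjv lee_fin.
  by move: fermat; rewrite /w !dotp_expand (dotpC q p) (dotpC q v); lra.
have gp : forall y, ((b + dotp v (y - p))%:E <= g y)%E.
  by move=> y; have := gq.2 y; rewrite gqb /w -pq (addrC p) addrK.
set h := fun y : H => _.
have hx : h x = (a + b + 2^-1 * `|x - z| ^+ 2)%:E by rewrite /h fxa -pE pq gqb.
(* In the sum of the two subgradient inequalities the terms in [adjoint L v] cancel, and the
   remaining [- <x - z | y - x>] completes the square. Both minimality and uniqueness of [x]
   follow. *)
have growth y : (h x + (2^-1 * `|y - x| ^+ 2)%:E <= h y)%E.
  have := leeD (fx.2 y) (gp (L y - r)); rewrite fxa.
  move=> /(leeD2r (2^-1 * `|y - z| ^+ 2)%:E); apply: le_trans.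
  rewrite hx -!EFinD lee_fin.
  have -> : L y - r - p = L (y - x) by rewrite pE opprB addrA subrK linearB.
  rewrite (dotpC v) dotp_adjoint//.
  have -> : u - x = - adjoint L v - (x - z) by rewrite /u opprB addrCA addrA.
  have -> : y - z = (y - x) + (x - z) by rewrite addrA subrK.
  move: (y - x) (x - z) (adjoint L v) => k l m.
  by rewrite -!dotpE !dotp_expand (dotpC m k) (dotpC l k); lra.
apply/seteqP; split=> [y ymin|_ -> y].
  have := le_trans (growth y) (ymin x); rewrite hx -EFinD lee_fin => yx.
  apply/eqP; rewrite -subr_eq0 -normr_eq0 -sqrf_eq0 -(rwP eqP).
  by apply/le_anti; rewrite sqr_ge0 andbT; lra.
apply: le_trans (growth y); rewrite hx -EFinD lee_fin.
by rewrite lerDl mulr_ge0// ?sqr_ge0 // invr_ge0.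
Qed.
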